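(* Let $k$ be a field, let $n\ge 2$ and $d\ge 2$ be integers, set $c:=\lfloor n/2\rfloor+1$, and let $f:\mathbf{P}^n_k\dashrightarrow\mathbf{P}^n_k$ be a birational map whose components $f_0,\dots,f_n$ are monomials of degree $d$ in the homogeneous coordinates $x_0,\dots,x_n$, with no common factors. Then $$d(f^{-1})\le (1-d^{-c})^{\frac{n-2}{c-1}}\,d^{n-1}.$$ Moreover, for fixed $n$ and $d\to\infty$, the right-hand side equals $d^{n-1}-\frac{n-2}{\lfloor n/2\rfloor}d^{\lfloor (n-3)/2\rfloor}+O(d^{-2})$.
   Context: $\mathbf{P}^n_k$ is the $n$-dimensional projective space over $k$, with homogeneous coordinates $x_0,\dots,x_n$. A map ''defined by monomials of degree $d$ with no common factors'' is $x\mapsto (f_0(x):\dots:f_n(x))$, where each $f_i=x_0^{a_{i0}}\cdots x_n^{a_{in}}$ is a monomial (with coefficient 1, $a_{ij}\in\mathbf{Z}_{\ge 0}$) with $\sum_{j} a_{ij}=d$ for every $i$, and no variable $x_j$ divides all of $f_0,\dots,f_n$. For a rational map $g:\mathbf{P}^n_k\dashrightarrow\mathbf{P}^n_k$, $d(g)$ denotes the common degree of homogeneous polynomials $g_0,\dots,g_n$ with no common factors defining $g$; in particular $d(f)=d$. *)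

(* Defs.v *)
From HB Require Import structures.
From mathcomp Require Import all_boot all_order all_algebra.
From mathcomp Require Import mpoly.

Set Implicit Arguments.
Unset Strict Implicit.
Unset Printing Implicit Defensive.

Import GRing.Theory.
Local Open Scope ring_scope.

Section RationalMaps.
Variables (k : fieldType) (n : nat).

(* The coordinates x_0, ..., x_n of P^n are the variables of {mpoly k[n.+1]}. *)
Definition form_tuple := n.+1.-tuple {mpoly k[n.+1]}.

(* The units of {mpoly k[n.+1]} are the nonzero constants, so this excludes
   common factors of positive degree as well as u = 0. *)
Definition no_common_factor (u : form_tuple) : Prop :=
  forall h : {mpoly k[n.+1]},
    (forall i, exists q, tnth u i = h * q) -> h \is a GRing.unit.

(* A rational map P^n --> P^n is given by homogeneous polynomials of the same
   degree without common factors; they are unique up to a common scalar, so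
   rat_deg g is the degree d(g). *)
Record ratmap := Ratmap {
  rat_forms : form_tuple;
  rat_deg : nat;
  rat_homog : forall i, tnth rat_forms i \is rat_deg.-homog;
  rat_coprime : no_common_factor rat_forms
}.

(* (u_0 : ... : u_n) and (v_0 : ... : v_n) are both defined and equal as points
   over the fraction field of {mpoly k[n.+1]}; common factors are allowed. *)
Definition same_map (u v : form_tuple) : Prop :=
  [/\ exists i, tnth u i != 0,
      exists i, tnth v i != 0 &
      forall i j, tnth u i * tnth v j = tnth u j * tnth v i].

(* g after f, before removal of the common factors. *)
Definition comp_forms (g f : ratmap) : form_tuple :=
  [tuple tnth (rat_forms g) i \mPo rat_forms f | i < n.+1].

Definition id_forms : form_tuple := [tuple 'X_i | i < n.+1].

Definition rat_inverse (f g : ratmap) : Prop :=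
  same_map (comp_forms g f) id_forms /\ same_map (comp_forms f g) id_forms.

Definition birational (f : ratmap) : Prop := exists g, rat_inverse f g.

Definition monomial_map (d : nat) (f : ratmap) : Prop :=
  exists a : 'M[nat]_n.+1,
    [/\ forall i, (\sum_j a i j)%N = d,
        forall j, exists i, a i j = 0%N &
        forall i, tnth (rat_forms f) i = \prod_j 'X_j ^+ a i j].

End RationalMaps.

(* Main.v *)
Require Import Defs.
From mathcomp Require Import all_boot all_order all_algebra.
From mathcomp Require mpoly.
From mathcomp Require Import ring lra zify.
Import Order.TTheory GRing.Theory Num.Theory.

(** Let A be the matrix of exponents of f; its rows a_k have sum d. The inverse
of f is again monomial ([monomial_inverse]): its exponent matrix B has row sums
D = d(f^-1), every column of B contains a zero, and AB and BA differ from the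
identity by matrices all of whose rows are equal. Everything else is about A
and B.

Bounding D by a volume. Fix a coordinate i0. Then D is the sum of the entries
B i0 j, and B i0 j is the normalised volume of a lattice simplex T_j: the
simplex spanned by the a_k with k <> j, projected to the hyperplane x_i0 = 0
along e_i0 - e_s, where s is a row with B s j = 0. All the T_j lie in the
simplex x >= 0, sum x = d, of normalised volume d^(n-1), and they have disjoint
interiors: the point of the j-th facet above a common point p would be at the
same time strictly higher and strictly lower than the point of the l-th facet
above p ([height_lt], [proj_inj]). Hence D <= d^(n-1).

Saving a corner. Let S be a set of c variables, x_i0 not among them, such that
every f_k is divisible by a variable of S. Then all the T_j lie in the region
where the coordinates of S have sum at least 1. For n >= 3 the corner cut
off has normalised volume at least 'C(n-1, c) (d-1)^(n-1-c), so that
  D + 'C(n-1, c) (d-1)^(n-1-c) <= d^(n-1)    ([degree_cut_le]).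
Volumes enter through numbers of lattice points: the tiles dilated by t are
parametrised by compositions ([tiles_le_upper]), the corner contains the points
counted in [upper_cut], and t tends to infinity ([leading_coefficient_le]).

Finding S with c = n/2 + 1 elements ([hitting_set]). Let p be a prime dividing
d. There is a row a_e such that the other rows are linearly independent modulo
p, while the all-one vector is in the kernel of A modulo p. So if Z is a
nonempty set of variables, fewer than #|Z| of these other monomials involve
only variables of Z. By an argument of Seymour the variables can then be coloured
with two colours so that every f_k with k <> e involves both colours: colour
by the signs of a rational kernel vector and recurse on its zeros. The smaller
colour class, together with a variable dividing f_e, is S.

With x = d^-c and e = (n-2)/(c-1), which is 0 or lies between 1 and 2, the
required bound is (1-x)^e d^(n-1), and a comparison of 2 d^(n-1-c) with the
volume of the corner finishes the proof ([degree_le_bound]). The asymptotic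
formula is the expansion (1-x)^e = 1 - e x + O(x^2) ([powR_taylor]), because
n-1-2c <= -2. *)

Set Implicit Arguments.
Unset Strict Implicit.
Unset Printing Implicit Defensive.

Local Open Scope ring_scope.

(** * Monomial maps and their inverses *)

(** The last two fields say that AB and BA are the identity plus a matrix with
equal rows; moving the Kronecker symbols across keeps them in the natural
numbers. *)
Record inverse_exponents (n d D : nat) (A B : 'I_n.+1 -> 'I_n.+1 -> nat) : Prop :=
  InverseExponents {
    ie_rowA : forall i, (\sum_j A i j)%N = d;
    ie_rowB : forall i, (\sum_j B i j)%N = D;
    ie_zeroB : forall j, exists i, B i j = 0%N;
    ie_AB : forall i l j, (\sum_k A i k * B k j + (l == j) =
                           \sum_k A l k * B k j + (i == j))%N;
    ie_BA : forall i l j, (\sum_k B i k * A k j + (l == j) =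
                           \sum_k B l k * A k j + (i == j))%N }.

Module MonomialInverse.
Import mpoly.

Section Exponents.
Variables (n : nat) (A : 'I_n.+1 -> 'I_n.+1 -> nat).

(** The exponent of the monomial X^m evaluated at (X^(a_0), ..., X^(a_n)). *)
Definition act (m : 'X_{1..n.+1}) : 'X_{1..n.+1} :=
  [multinom (\sum_l m l * A l j)%N | j < n.+1].

Lemma actE m j : act m j = (\sum_l m l * A l j)%N.
Proof. exact: mnmE. Qed.

Lemma actD m m' : act (m + m')%MM = (act m + act m')%MM.
Proof.
apply/mnmP => j; rewrite mnmDE !actE -big_split /=.
by apply: eq_bigr => l _; rewrite mnmDE mulnDl.
Qed.

(** The hypothesis puts all differences e_i - e_i0 in the row space of A, so a
vector u with A u = 0 is constant; as A 1 = d 1, it vanishes. *)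
Lemma act_inj (d : nat) (beta : 'I_n.+1 -> 'X_{1..n.+1}) (i0 : 'I_n.+1) :
  (0 < d)%N -> (forall i, \sum_j A i j = d)%N ->
  (forall i, act (beta i) + U_(i0) = act (beta i0) + U_(i))%MM ->
  injective act.
Proof.
move=> d0 rowA hb.
pose M : 'M[rat]_n.+1 := \matrix_(i, j) (A i j)%:R.
have rowM i : \sum_j M i j = d%:R.
  by rewrite -(rowA i) natr_sum; apply: eq_bigr => j _; rewrite mxE.
have M_unit : M \in unitmx.
  rewrite -unitmx_tr -row_free_unit -kermx_eq0.
  apply/rowV0P => u /sub_kermxP uM.
  have Mu i : \sum_j M i j * u 0 j = 0.
    have := congr1 (fun w : 'rV__ => w 0 i) uM; rewrite !mxE => e.
    by rewrite -[RHS]e; apply: eq_bigr => j _; rewrite !mxE mulrC.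
  have uc i : u 0 i = u 0 i0.
    have e1 (b : 'X_{1..n.+1}) : \sum_j (act b j)%:R * u 0 j = 0.
      under eq_bigr => j _.
        rewrite actE natr_sum mulr_suml.
        under eq_bigr => l _ do rewrite natrM -mulrA.
        over.
      rewrite exchange_big /= big1 // => l _; rewrite -mulr_sumr.
      rewrite (_ : \sum_j _ = 0) ?mulr0 // -[RHS](Mu l).
      by apply: eq_bigr => j _; rewrite mxE.
    have eU (a : 'I_n.+1) : \sum_j (U_(a)%MM j)%:R * u 0 j = u 0 a.
      rewrite (bigD1 a) //= mnm1E eqxx mul1r big1 ?addr0 // => j ja.
      by rewrite mnm1E eq_sym (negPf ja) mul0r.
    have : \sum_j ((act (beta i) + U_(i0))%MM j)%:R * u 0 j =
           \sum_j ((act (beta i0) + U_(i))%MM j)%:R * u 0 j by rewrite hb.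
    under eq_bigr => j _ do rewrite mnmDE natrD mulrDl.
    under [X in _ = X -> _]eq_bigr => j _ do rewrite mnmDE natrD mulrDl.
    by rewrite !big_split /= !e1 !eU !add0r => ->.
  have : d%:R * u 0 i0 = 0.
    rewrite -(rowM i0) mulr_suml -[RHS](Mu i0).
    by apply: eq_bigr => j _; rewrite (uc j).
  move/eqP; rewrite mulf_eq0 pnatr_eq0 eqn0Ngt d0 /= => /eqP u0.
  by apply/rowP => j; rewrite uc u0 mxE.
move=> m m' e; pose r (b : 'X_{1..n.+1}) : 'rV[rat]_n.+1 := \row_j (b j)%:R.
have rM b : r b *m M = \row_j (act b j)%:R.
  apply/rowP => j; rewrite !mxE actE natr_sum.
  by apply: eq_bigr => l _; rewrite !mxE natrM.
have /(congr1 (mulmx^~ (invmx M))) : r m *m M = r m' *m M by rewrite !rM e.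
rewrite !mulmxK // => /rowP e'; apply/mnmP => j; apply/eqP.
by move: (e' j); rewrite !mxE => /eqP; rewrite eqr_nat.
Qed.

End Exponents.

Section Inverse.
Variables (k : fieldType) (n d : nat) (f g : ratmap k n).
Hypothesis d_gt0 : (0 < d)%N.
Variable A : 'I_n.+1 -> 'I_n.+1 -> nat.
Hypothesis rowA : (forall i, \sum_j A i j = d)%N.
Hypothesis fA : forall i, tnth (rat_forms f) i = \prod_j 'X_j ^+ A i j.
Hypothesis fg : rat_inverse f g.

Let G i := tnth (rat_forms g) i.

Lemma comp_monomial m : 'X_[m] \mPo rat_forms f = 'X_[act A m] :> {mpoly k[n.+1]}.
Proof.
rewrite comp_mpolyX mpolyXE_id.
under eq_bigr => i _.
  rewrite fA -prodrXl.
  under eq_bigr => j _ do rewrite -exprM.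
  over.
rewrite exchange_big /=; apply: eq_bigr => j _.
rewrite prodrXr actE; congr (_ ^+ _).
by apply: eq_bigr => l _; rewrite mulnC.
Qed.

Lemma comp_monomialE p :
  p \mPo rat_forms f = \sum_(m <- msupp p) p@_m *: 'X_[act A m].
Proof.
by rewrite comp_mpolyEX; apply: eq_bigr => m _; rewrite comp_monomial.
Qed.

Lemma mem_supp_comp p mu : mu \in msupp (p \mPo rat_forms f) ->
  exists2 b, b \in msupp p & act A b = mu.
Proof.
rewrite comp_monomialE mcoeff_msupp raddf_sum /= => nz.
have [/hasP[b bp /eqP e]|/hasPn h] := boolP (has (fun b => act A b == mu) (msupp p)).
  by exists b.
move: nz; rewrite big_seq big1 ?eqxx // => b bp.
by rewrite mcoeffZ mcoeffX (negPf (h b bp)) mulr0.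
Qed.

Lemma mcoeff_comp p m : injective (act A) ->
  (p \mPo rat_forms f)@_(act A m) = p@_m.
Proof.
move=> inj; rewrite comp_monomialE raddf_sum /=.
under eq_bigr => b _ do rewrite mcoeffZ mcoeffX (inj_eq inj).
rewrite [in RHS](mpolyE p) raddf_sum /=.
by apply: eq_bigr => b _; rewrite mcoeffZ mcoeffX.
Qed.

Lemma comp_inj : injective (act A) -> injective (comp_mpoly (rat_forms f)).
Proof.
move=> inj p q e; apply/mpolyP => m.
by rewrite -(mcoeff_comp p _ inj) e mcoeff_comp.
Qed.

(** The equation of the composite g o f with the identity. *)
Lemma gf_cross i j : (G i \mPo rat_forms f) * 'X_j = (G j \mPo rat_forms f) * 'X_i.
Proof. case: fg => [[_ _ H] _]; have := H i j; rewrite /comp_forms /id_forms !tnth_mktuple; exact.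
Qed.

Lemma X_neq0 (m : 'X_{1..n.+1}) : 'X_[m] != 0 :> {mpoly k[n.+1]}.
Proof. by rewrite -msupp_eq0 msuppX. Qed.

Lemma gf_neq0 i : G i \mPo rat_forms f != 0.
Proof.
case: fg => [[[j nz] _ _] _]; move: nz; rewrite /comp_forms tnth_mktuple => nz.
apply/eqP => z; have := gf_cross i j; rewrite z mul0r => /esym /eqP.
by rewrite mulf_eq0 (negPf (X_neq0 _)) orbF (negPf nz).
Qed.

Lemma mem_suppMX (p : {mpoly k[n.+1]}) i m :
  ((m + U_(i))%MM \in msupp (p * 'X_i)) = (m \in msupp p).
Proof. by rewrite addmC !mcoeff_msupp mcoeffMX. Qed.

(** The terms of g_i(f) and g_j(f) correspond to each other through
multiplication by X_j / X_i, and each of them comes from a term of g_i, resp.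
g_j. *)
Lemma transfer i j mu : mu \in msupp (G i \mPo rat_forms f) ->
  exists2 b, b \in msupp (G j) & (act A b + U_(i) = mu + U_(j))%MM.
Proof.
rewrite -(mem_suppMX _ j) gf_cross => h.
have : (mu + U_(j))%MM \in [seq (U_(i) + m)%MM | m <- msupp (G j \mPo rat_forms f)].
  by rewrite -(perm_mem (msuppMX _ _)).
case/mapP => nu /mem_supp_comp[b bG <-] ->; exists b => //; exact: addmC.
Qed.

(** Following one term of g_i0(f) through the other components yields exponents
beta_i with act (beta_i) - act (beta_i0) = e_i - e_i0. Subtracting from the
beta_i their common part gives exponents b_i such that g_i = h X^(b_i) with a
polynomial h that does not depend on i. The components of g have no common
factor, so h is a constant. *)
Lemma monomial_inverse : exists B, inverse_exponents d (rat_deg g) A B.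
Proof.
pose i0 : 'I_n.+1 := ord0.
have [mu mu0] : exists mu, mu \in msupp (G i0 \mPo rat_forms f).
  have := gf_neq0 i0; rewrite -msupp_eq0.
  by case: (msupp _) => // mu s _; exists mu; rewrite mem_head.
have /fin_all_exists[beta hbeta] i : exists b : 'X_{1..n.+1},
    b \in msupp (G i) /\ (act A b + U_(i0) = mu + U_(i))%MM.
  by have [b] := transfer i mu0; exists b.
have mu_beta : mu = act A (beta i0).
  have [_ /mnmP e] := hbeta i0; apply/mnmP => j.
  by have := e j; rewrite !mnmDE => /addIn.
have relb i : (act A (beta i) + U_(i0) = act A (beta i0) + U_(i))%MM.
  by rewrite -mu_beta; case: (hbeta i).
have inj := act_inj d_gt0 rowA relb.
pose low j := [arg min_(i < i0) beta i j].
have lowP j i : (beta (low j) j <= beta i j)%N.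
  by rewrite /low; case: arg_minnP => // l _; apply.
pose b i : 'X_{1..n.+1} := [multinom (beta i j - beta (low j) j)%N | j < n.+1].
have bE i j : b i j = (beta i j - beta (low j) j)%N by rewrite mnmE.
(* This makes X^(b_i0) a divisor of g_i0, so that the quotient h exists. *)
have le_b m : m \in msupp (G i0) -> (b i0 <= m)%MM.
  move=> mG; apply/mnm_lepP => j; rewrite bE.
  have mGf : act A m \in msupp (G i0 \mPo rat_forms f).
    by rewrite mcoeff_msupp mcoeff_comp // -mcoeff_msupp.
  have [m' _ e] := transfer (low j) mGf.
  have : act A (m' + beta i0)%MM = act A (m + beta (low j))%MM.
    apply/mnmP => l; move/mnmP/(_ l): e; move/mnmP/(_ l): (relb (low j)).
    rewrite !actD !mnmDE; lia.
  move/inj/mnmP/(_ j); rewrite !mnmDE; lia.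
pose h : {mpoly k[n.+1]} := \sum_(m <- msupp (G i0)) (G i0)@_m *: 'X_[m - b i0].
have G0h : G i0 = h * 'X_[b i0].
  rewrite {1}(mpolyE (G i0)) /h mulr_suml big_seq [RHS]big_seq.
  apply: eq_bigr => m mG; rewrite -scalerAl -mpolyXD; congr (_ *: 'X_[_]).
  by apply/mnmP => j; rewrite mnmDE mnmBE subnK //; apply/mnm_lepP: j; apply: le_b.
have relb' i : (act A (b i) + U_(i0) = act A (b i0) + U_(i))%MM.
  pose w : 'X_{1..n.+1} := [multinom beta (low j) j | j < n.+1].
  have bw l : beta l = (b l + w)%MM.
    by apply/mnmP => j; rewrite mnmDE bE mnmE subnK // lowP.
  apply/mnmP => j; move/mnmP/(_ j): (relb i); rewrite (bw i) (bw i0) !actD !mnmDE.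
  lia.
have Gh i : G i = h * 'X_[b i].
  apply: (comp_inj inj); apply/eqP.
  rewrite -(inj_eq (mulIf (X_neq0 U_(i0)%MM))) gf_cross G0h !rmorphM /=.
  by rewrite !comp_monomial -!mulrA -!mpolyXD relb'.
have h_unit : h \is a GRing.unit.
  have cop := rat_coprime (r := g); apply: cop => i.
  by exists 'X_[b i]; rewrite -Gh.
have [c c0 hc] : exists2 c, c != 0 & h = c%:MP.
  move: h_unit; rewrite unfold_in /= /mpoly_unit => /andP[/eqP hC cu].
  by exists h@_0; rewrite -?unitfE.
exists (fun i j => b i j); split => //.
- move=> i; have : G i \is (rat_deg g).-homog := rat_homog g i.
  rewrite Gh hc mul_mpolyC => /dhomogP/(_ (b i)).
  by rewrite msuppMCX // mem_head => /(_ isT); rewrite /= mdegE.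
- by move=> j; exists (low j); rewrite bE subnn.
(* AB is obtained from BA by comparing both sides after the injective [act]. *)
- move=> i l j.
  pose P i : 'X_{1..n.+1} := [multinom (\sum_k A i k * b k j)%N | j < n.+1].
  have PE a j' : P a j' = (\sum_k A a k * b k j')%N by rewrite mnmE.
  have actU a j' : act A U_(a)%MM j' = A a j'.
    rewrite actE (bigD1 a) //= mnm1E eqxx mul1n big1 ?addn0 // => x xa.
    by rewrite mnm1E eq_sym (negPf xa).
  have actP a j' :
      (act A (P a) j' + d * (i0 == j') = d * act A (b i0) j' + A a j')%N.
    have -> : act A (P a) j' = (\sum_k A a k * act A (b k) j')%N.
      rewrite actE; under eq_bigr => x _ do rewrite PE big_distrl /=.
      rewrite exchange_big; apply: eq_bigr => x _.
      by rewrite actE big_distrr /=; apply: eq_bigr => y _; rewrite mulnA.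
    rewrite -(rowA a) !big_distrl /= -big_split /=.
    transitivity (\sum_x (A a x * act A (b i0) j' + A a x * (x == j')))%N.
      apply: eq_bigr => x _; rewrite -!mulnDr; congr (_ * _)%N.
      by move/mnmP/(_ j'): (relb' x); rewrite !mnmDE !mnm1E.
    rewrite big_split /=; congr (_ + _)%N.
    rewrite (bigD1 j') //= eqxx muln1 big1 ?addn0 // => x xj.
    by rewrite (negPf xj) muln0.
  have : act A (P i + U_(l))%MM = act A (P l + U_(i))%MM.
    apply/mnmP => j'; rewrite !actD !mnmDE !actU.
    have := actP i j'; have := actP l j'; lia.
  by move/inj/mnmP/(_ j); rewrite !mnmDE !PE !mnm1E.
- move=> i l j; move/mnmP/(_ j): (relb' i); move/mnmP/(_ j): (relb' l).
  rewrite !mnmDE !mnm1E !actE; lia.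
Qed.
End Inverse.

End MonomialInverse.

(** * A small set of variables meeting every monomial *)

Section Hitting.
Variables (n d D : nat) (A B : 'I_n.+1 -> 'I_n.+1 -> nat).
Hypothesis d_gt1 : (1 < d)%N.
Hypothesis AB : inverse_exponents d D A B.

(** Write AB = I + 1 lam. The entries of lam have sum dD - 1, which is -1 modulo
p, so some lam_e0 is nonzero modulo p. If c A = 0 then 0 = c A B = c + (sum c)
lam; the coordinate e0 gives sum c = 0, hence c = 0. *)
Lemma rows_independent_modp (p : nat) : prime p -> (p %| d)%N ->
  exists e0, forall c : 'I_n.+1 -> 'F_p, c e0 = 0 ->
    (forall j, \sum_k c k * (A k j)%:R = 0) -> forall k, c k = 0.
Proof.
move=> p_pr pd.
pose P i j : 'F_p := (\sum_k A i k * B k j)%N%:R.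
pose lam j : 'F_p := P ord0 j - (ord0 == j)%:R.
have PE i j : P i j = lam j + (i == j)%:R.
  have := congr1 (fun m : nat => m%:R : 'F_p) (ie_AB AB i ord0 j).
  rewrite /= !natrD /lam /P => e; rewrite addrAC -e; ring.
have d0 : d%:R = 0 :> 'F_p.
  by apply/eqP; rewrite -(dvdn_pcharf (pchar_Fp p_pr)).
have sum_lam : \sum_j lam j = -1.
  have one : \sum_j (ord0 == j :> 'I_n.+1)%:R = 1 :> 'F_p.
    by rewrite (bigD1 ord0) //= big1 ?addr0 // => j /negPf; rewrite eq_sym => ->.
  rewrite sumrB one -natr_sum exchange_big /=.
  under eq_bigr => k _ do rewrite -big_distrr /= (ie_rowB AB).
  by rewrite -big_distrl /= (ie_rowA AB) natrM d0 mul0r add0r.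
have [e0 le0] : exists e0, lam e0 != 0.
  apply/existsP; apply: contraT; rewrite negb_exists => /forallP z.
  have := sum_lam; rewrite big1 => [/esym/eqP|j _]; last by apply/eqP; rewrite -[_ == _]negbK.
  by rewrite oppr_eq0 oner_eq0.
exists e0 => c ce0 cA.
have cP m : (\sum_k c k) * lam m + c m = 0.
  transitivity (\sum_k c k * P k m).
    under [RHS]eq_bigr => k _ do rewrite PE mulrDr.
    rewrite big_split /= -mulr_suml; congr (_ + _).
    rewrite (bigD1 m) //= eqxx mulr1 big1 ?addr0 // => k /negPf km.
    by rewrite km mulr0.
  under eq_bigr => k _.
    rewrite /P natr_sum mulr_sumr.
    under eq_bigr => j _ do rewrite natrM mulrA.
    over.
  rewrite exchange_big /= big1 // => j _.
  by rewrite -mulr_suml cA mul0r.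
have c0 : \sum_k c k = 0.
  have /eqP := cP e0; rewrite ce0 addr0 mulf_eq0 (negPf le0) orbF => /eqP //.
by move=> k; have := cP k; rewrite c0 mul0r add0r.
Qed.

(** The monomials other than the one of row e0 that involve only variables of
Z. *)
Definition inside (e0 : 'I_n.+1) (Z : {set 'I_n.+1}) : {set 'I_n.+1} :=
  [set k | (k != e0) && [forall j, (0 < A k j)%N ==> (j \in Z)]].

(** Modulo a prime divisor of d, the rows in question are independent but their
restriction to Z has the all-one vector in its kernel. *)
Lemma inside_card : exists e0, forall Z : {set 'I_n.+1},
  (0 < #|Z|)%N -> (#|inside e0 Z| < #|Z|)%N.
Proof.
have p_pr := pdiv_prime d_gt1; have pd := pdiv_dvd d.
have [e0 indep] := rows_independent_modp p_pr pd.
exists e0 => Z Z0; set F := inside e0 Z.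
have FZ k j : k \in F -> j \notin Z -> A k j = 0%N.
  rewrite inE => /andP[_ /forallP/(_ j)]; case: posnP => //= _ ->; by [].
have Fe0 k : k \in F -> k != e0 by rewrite inE => /andP[].
pose M : 'M['F_(pdiv d)]_(#|F|, #|Z|) :=
  \matrix_(i, j) (A (enum_val i) (enum_val j))%:R.
have M_free : row_free M.
  apply/inj_row_free => v vM.
  pose c k : 'F_(pdiv d) := \sum_i v 0 i * (enum_val i == k)%:R.
  have cv i : c (enum_val i) = v 0 i.
    rewrite /c (bigD1 i) //= eqxx mulr1 big1 ?addr0 // => i' ne.
    by rewrite (inj_eq enum_val_inj) (negPf ne) mulr0.
  apply/rowP => i; rewrite mxE -cv; apply: indep.
    rewrite /c big1 // => i' _.
    by rewrite (negPf (Fe0 _ (enum_valP i'))) mulr0.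
  move=> j; transitivity (\sum_i v 0 i * (A (enum_val i) j)%:R).
    rewrite /c; under eq_bigr => k _ do rewrite mulr_suml.
    rewrite exchange_big; apply: eq_bigr => i' _ /=.
    rewrite (bigD1 (enum_val i')) //= eqxx mulr1 big1 ?addr0 // => k.
    by rewrite eq_sym => /negPf ->; rewrite mulr0 mul0r.
  have [jZ|jZ] := boolP (j \in Z); last first.
    by rewrite big1 // => i' _; rewrite (FZ _ _ (enum_valP i')) // mulr0.
  have := congr1 (fun w : 'rV__ => w 0 (enum_rank_in jZ j)) vM.
  rewrite !mxE => e; rewrite -[RHS]e; apply: eq_bigr => i' _.
  by rewrite mxE enum_rankK_in.
have M1 : M *m const_mx 1 = 0 :> 'cV_#|F|.
  apply/colP => i; rewrite !mxE.
  under eq_bigr => j _ do rewrite !mxE mulr1.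
  rewrite -natr_sum; apply/eqP; rewrite -(dvdn_pcharf (pchar_Fp p_pr)).
  suff -> : (\sum_(j < #|Z|) A (enum_val i) (enum_val j) = d)%N by [].
  rewrite -(big_enum_val (A := mem Z) (fun j => A (enum_val i) j)) /=.
  rewrite -(ie_rowA AB (enum_val i)) [RHS](bigID (mem Z)) /=.
  rewrite [X in (_ + X)%N]big1 ?addn0 // => j jZ.
  by rewrite (FZ _ _ (enum_valP i)).
rewrite ltn_neqAle; apply/andP; split; last first.
  by rewrite -{1}(eqP M_free) rank_leq_col.
apply/eqP => e; have : row_full M by rewrite /row_full (eqP M_free) e.
case/row_fullP => C CM.
have : C *m (M *m const_mx 1) = 0 :> 'cV_#|Z| by rewrite M1 mulmx0.
rewrite mulmxA CM mul1mx => /colP/(_ (Ordinal Z0))/eqP.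
by rewrite !mxE oner_eq0.
Qed.

Lemma inside_kernel (e0 : 'I_n.+1) (Z : {set 'I_n.+1}) :
  (#|inside e0 Z| < #|Z|)%N ->
  exists x : 'I_n.+1 -> rat, [/\ exists2 j, j \in Z & x j != 0,
     forall j, j \notin Z -> x j = 0 &
     forall k, k \in inside e0 Z -> \sum_j (A k j)%:R * x j = 0].
Proof.
set F := inside e0 Z => FZ.
pose M : 'M[rat]_(#|Z|, #|F|) :=
  \matrix_(j, i) (A (enum_val i) (enum_val j))%:R.
have : kermx M != 0.
  rewrite -mxrank_eq0 mxrank_ker -lt0n subn_gt0.
  by rewrite (leq_ltn_trans (rank_leq_col _)).
case/rowV0Pn => v /sub_kermxP vM v0.
pose x k : rat := \sum_i v 0 i * (enum_val i == k)%:R.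
have xv i : x (enum_val i) = v 0 i.
  rewrite /x (bigD1 i) //= eqxx mulr1 big1 ?addr0 // => i' ne.
  by rewrite (inj_eq enum_val_inj) (negPf ne) mulr0.
have xZ j : j \notin Z -> x j = 0.
  move=> jZ; rewrite /x big1 // => i _.
  case: eqP => [e|_]; last by rewrite mulr0.
  by move: jZ; rewrite -e enum_valP.
exists x; split=> //.
  move: v0; case/rV0Pn => i vi.
  by exists (enum_val i); rewrite ?enum_valP // xv.
move=> k kF; rewrite (bigID (mem Z)) /= [X in _ + X]big1 ?addr0; last first.
  by move=> j jZ; rewrite xZ ?mulr0.
rewrite big_enum_val /=.
have := congr1 (fun w : 'rV__ => w 0 (enum_rank_in kF k)) vM.
rewrite !mxE => e; rewrite -[RHS]e; apply: eq_bigr => i _.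
by rewrite mxE enum_rankK_in // xv mulrC.
Qed.

(** Induction on the set Z of variables to be coloured: a monomial inside Z has
exponents orthogonal to the kernel vector x, so either x takes both signs on
its variables or it vanishes on all of them. *)
Lemma two_colouring : exists (e0 : 'I_n.+1) (col : 'I_n.+1 -> bool),
  forall k b, k != e0 -> exists2 j, (0 < A k j)%N & col j = b.
Proof.
have [e0 card_lt] := inside_card; exists e0.
suff H m (Z : {set 'I_n.+1}) : (#|Z| <= m)%N -> exists col : 'I_n.+1 -> bool,
    forall k b, k \in inside e0 Z -> exists2 j, (0 < A k j)%N & col j = b.
  have [col colP] := H _ _ (leqnn #|[set: 'I_n.+1]|); exists col => k b ke.
  apply: colP; rewrite inE ke; apply/forallP => j; by rewrite in_setT implybT.
elim: m Z => [|m IH] Z.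
  rewrite leqn0 cards_eq0 => /eqP ->; exists xpredT => k b.
  rewrite inE => /andP[_ /forallP h]; exfalso.
  have := ie_rowA AB k; rewrite big1 => [e|j _]; first by have := d_gt1; rewrite -e.
  by have := h j; rewrite inE implybF -leqNgt leqn0 => /eqP.
move=> Zm; have [Z0|Z0] := posnP #|Z|; first by apply: IH; rewrite Z0.
have [x [[j0 j0Z xj0] xZ xF]] := inside_kernel (card_lt _ Z0).
pose Z' := [set j in Z | x j == 0].
have [] := IH Z'.
  rewrite -ltnS (leq_trans _ Zm) // proper_card //; apply/properP; split.
    by apply/subsetP => j; rewrite inE => /andP[].
  by exists j0; rewrite // inE (negPf xj0) andbF.
move=> col' col'P.
exists (fun j => if x j == 0 then col' j else 0 < x j) => k b kF.
have [/forallP z|] := boolP [forall j, (0 < A k j)%N ==> (x j == 0)].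
  have kZ' : k \in inside e0 Z'.
    move: kF; rewrite !inE => /andP[-> /forallP h]; apply/forallP => j.
    by apply/implyP => a; rewrite inE (implyP (h j)) //= (implyP (z j)).
  have [j aj cj] := col'P k b kZ'.
  by exists j; rewrite // (implyP (z j)).
rewrite negb_forall => /existsP[j1]; rewrite negb_imply => /andP[a1 x1].
have sum0 := xF k kF.
suff [j aj xj] : exists2 j, (0 < A k j)%N & (if b then 0 < x j else x j < 0).
  exists j => //; case: eqP => [e|_]; first by move: xj; rewrite e ltxx if_same.
  by case: (b) xj => // /ltW; rewrite leNgt => /negPf.
apply/exists_inP; apply: contraT; rewrite negb_exists_in => /forall_inP no.
pose y j := if b then - x j else x j.
have y_ge0 j : (0 < A k j)%N -> 0 <= y j.
  by move=> /no; rewrite /y; case: (b); rewrite -leNgt ?oppr_ge0.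
have : \sum_j (A k j)%:R * y j = 0.
  rewrite /y; case: (b) => //.
  by under eq_bigr => j _ do rewrite mulrN; rewrite sumrN sum0 oppr0.
move/eqP; rewrite psumr_eq0 => [/allP/(_ j1)|j _]; last first.
  have [->|/y_ge0 yj] := posnP (A k j); first by rewrite mul0r.
  by rewrite mulr_ge0 ?ler0n.
rewrite mem_index_enum => /(_ isT) /=; rewrite mulf_eq0 pnatr_eq0 eqn0Ngt a1 /=.
by rewrite /y; case: (b); rewrite ?oppr_eq0 (negPf x1).
Qed.

(** Away from a variable v dividing the exceptional monomial, one colour class
has at most n/2 elements. The set is enlarged so that its cardinality does not
depend on the map. *)
Lemma hitting_set : exists S : {set 'I_n.+1},
  #|S| = (n %/ 2).+1 /\ forall k, (0 < \sum_(j in S) A k j)%N.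
Proof.
have [e0 [col colP]] := two_colouring.
have [v v0] : exists v, (0 < A e0 v)%N.
  apply/existsP; apply: contraT; rewrite negb_exists => /forallP z.
  move: d_gt1; rewrite -(ie_rowA AB e0) big1 // => j _.
  by apply/eqP; rewrite eqn0Ngt.
pose C b := [set j | (j != v) && (col j == b)].
have [b Cb] : exists b, (#|C b| <= n %/ 2)%N.
  apply/existsP; apply: contraT; rewrite negb_exists => /forallP h.
  have := h true; have := h false; rewrite -!ltnNge => h0 h1.
  have : (#|C true| + #|C false| <= n)%N.
    have e : #|[set~ v]| = n by rewrite cardsC1 card_ord.
    rewrite -[leqRHS]e -cardsUI (_ : C true :&: C false = set0) ?cards0 ?addn0.
      by apply/subset_leq_card/subsetP => j; rewrite !inE => /orP[] /andP[].
    by apply/setP => j; rewrite !inE; case: (col j); rewrite ?andbF.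
  have := divn_eq n 2; have := ltn_pmod n (isT : 0 < 2)%N; lia.
have hit (S : {set 'I_n.+1}) j k : j \in S -> (0 < A k j)%N ->
    (0 < \sum_(j in S) A k j)%N.
  by move=> jS a; rewrite (bigD1 j) //= ltn_addr.
pose S0 := v |: C b.
have S0c : (#|S0| <= (n %/ 2).+1)%N by rewrite cardsU1 !inE eqxx /= add1n.
have [S S0S Sc] : exists2 S : {set 'I_n.+1}, S0 \subset S & #|S| = (n %/ 2).+1.
  have le : ((n %/ 2).+1 - #|S0| <= #|~: S0|)%N.
    rewrite [X in (_ <= X)%N]cardsCs setCK card_ord leq_sub2r // ltnS.
    exact: leq_div.
  have [sT [uT Ts Tsub]] := card_geqP le.
  exists (S0 :|: [set x in sT]); first exact: subsetUl.
  rewrite cardsU (_ : S0 :&: _ = set0) ?cards0 ?subn0.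
    have -> : #|[set x in sT]| = size sT by rewrite cardsE; apply/card_uniqP.
    by rewrite Ts subnKC.
  apply/setP => x; rewrite !inE; apply/negP => /andP[xS /Tsub].
  by rewrite !inE xS.
exists S; split => // k.
have [->|ke] := eqVneq k e0.
  by apply: (hit _ v) => //; apply: (subsetP S0S); rewrite !inE eqxx.
have [j aj cj] := colP k b ke.
apply: (hit _ j) => //; apply: (subsetP S0S); rewrite !inE cj eqxx andbT.
exact: orbN.
Qed.
End Hitting.

(** * Compositions *)

Section Compositions.
Variables (I : finType) (T : nat).

(** Compositions of M with parts indexed by A. The bound T is common to all of
them, so that compositions of different integers live in the same finite
type. *)
Definition comps (A : {set I}) (M : nat) : {set {ffun I -> 'I_T.+1}} :=
  [set f : {ffun I -> 'I_T.+1} | [forall i, (i \notin A) ==> (f i == 0%N :> nat)] &&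
           ((\sum_i f i)%N == M)].

Lemma compsP (A : {set I}) M (f : {ffun I -> 'I_T.+1}) :
  reflect ((forall i, i \notin A -> f i = 0%N :> nat) /\ (\sum_i f i = M)%N)
          (f \in comps A M).
Proof.
rewrite inE; apply: (iffP andP) => -[h /eqP e]; split => //.
- by move=> i iA; apply/eqP/(implyP (forallP h i)).
by apply/forallP => i; apply/implyP => iA; apply/eqP/h.
Qed.

Lemma card_comps (A : {set I}) M : (0 < #|A|)%N -> (M <= T)%N ->
  #|comps A M| = 'C(#|A|.-1 + M, #|A|.-1).
Proof.
move=> A0 MT; have [x0 x0A] := card_gt0P A0.
have sz : size (enum A) = #|A|.-1.+1 by rewrite -cardE prednK.
rewrite -card_ord_partitions.
pose h (t : #|A|.-1.+1.-tuple 'I_M.+1) : {ffun I -> 'I_T.+1} :=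
  [ffun i => if i \in A then inord (nth ord0 t (index i (enum A))) else ord0].
have hE t i : i \in A -> h t i = nth ord0 t (index i (enum A)) :> nat.
  move=> iA; rewrite ffunE iA inordK // ltnS.
  by apply: leq_trans MT; rewrite -ltnS.
have sumA (F : I -> nat) : (forall i, i \notin A -> F i = 0%N) ->
    (\sum_i F i = \sum_(l < #|A|.-1.+1) F (nth x0 (enum A) l))%N.
  move=> F0; rewrite (bigID (mem A)) /= addnC big1 ?add0n // -big_enum.
  by rewrite (big_nth x0) big_mkord sz.
have nthA (l : 'I_#|A|.-1.+1) : nth x0 (enum A) l \in A.
  by rewrite -mem_enum mem_nth // sz.
have inj : injective h.
  move=> t t' e; apply: eq_from_tnth => l; apply: val_inj.
  rewrite !(tnth_nth ord0) /= -[l : nat](@index_uniq _ x0 _ (enum A)) ?enum_uniq ?sz //.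
  by rewrite -!hE // e.
rewrite -[RHS](card_imset _ inj); apply: eq_card => f.
apply/compsP/imsetP => [[f0 fM]|[t]].
  have fle i : (f i <= M)%N by rewrite -fM (bigD1 i) //= leq_addr.
  pose t : #|A|.-1.+1.-tuple 'I_M.+1 :=
    [tuple inord (f (nth x0 (enum A) l)) | l < #|A|.-1.+1].
  exists t.
    rewrite inE big_tuple; apply/eqP; rewrite -[RHS]fM sumA //.
    apply: eq_bigr => l _.
    by rewrite tnth_mktuple inordK // ltnS.
  apply/ffunP => i; apply: val_inj => /=.
  have [iA|iA] := boolP (i \in A); last by rewrite ffunE (negPf iA) f0.
  rewrite hE //; have li : (index i (enum A) < #|A|.-1.+1)%N.
    by rewrite -sz index_mem mem_enum.
  rewrite -[index i _]/(val (Ordinal li)) -tnth_nth tnth_mktuple.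
  by rewrite /= nth_index ?mem_enum // inordK // ltnS.
rewrite inE big_tuple => /eqP tM ->; split=> [i /negPf iA|].
  by rewrite ffunE iA.
rewrite sumA => [|i /negPf iA]; last by rewrite ffunE iA.
rewrite -[RHS]tM; apply: eq_bigr => l _.
by rewrite hE // index_uniq ?enum_uniq ?sz // -tnth_nth.
Qed.

End Compositions.

(** * Disjoint lattice tiles *)

Section Tiles.
Variables (n d D : nat) (A B : 'I_n.+1 -> 'I_n.+1 -> nat).
Hypothesis AB : inverse_exponents d D A B.
Variables (i0 : 'I_n.+1) (t : nat) (S : {set 'I_n.+1}).
Hypothesis i0S : i0 \notin S.
Hypothesis hitS : forall k, (0 < \sum_(j in S) A k j)%N.
Hypothesis n_gt0 : (0 < n)%N.
Hypothesis le_nt : (n <= t)%N.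
Let N := 'I_n.+1.

(** The tile T_j is obtained by projecting along e_i0 - e_s with
s = [zero_row j]. *)
Definition zero_row j : N := odflt i0 [pick i | B i j == 0%N].

Lemma zero_rowP j : B (zero_row j) j = 0%N.
Proof.
rewrite /zero_row; case: pickP => [i /eqP //|h].
by have [i e] := ie_zeroB AB j; have := h i; rewrite e eqxx.
Qed.

Definition vol j : int := (B i0 j)%:Z.
(** The coordinates of e_i0 - e_s in terms of the rows of A
([act_delta]). *)
Definition delta j k : int := (B i0 k)%:Z - (B (zero_row j) k)%:Z.
Definition act (c : N -> int) i : int := \sum_k c k * (A k i)%:Z.

(** A lattice point is represented by integral coefficients c with respect to
the rows of A, up to multiples of [delta j]. In each class there is one c with
0 <= c j < vol j; subtracting the rational multiple (c j / vol j) of [delta j]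
moves the point to the facet where the j-th coefficient vanishes, and it lies
in the interior of the t-fold dilated facet exactly when the remaining
coefficients are positive and have sum t. *)
Definition in_tile j (c : N -> int) : Prop :=
  [/\ 0 <= c j < vol j, \sum_k c k = t%:Z &
      forall k, k != j -> c j * delta j k < vol j * c k].

Definition proj j (c : N -> int) i : int :=
  if i == i0 then 0 else act c i + (if i == zero_row j then act c i0 else 0).

(** The coefficients on the facet, multiplied by [vol j] to stay integral. *)
Definition lift_back j (c : N -> int) k : int := vol j * c k - c j * delta j k.

Lemma delta_id j : delta j j = vol j.
Proof. by rewrite /delta zero_rowP subr0. Qed.

Lemma vol_gt0 j c : in_tile j c -> 0 < vol j.
Proof. by case=> /andP[c0 cq] _ _; apply: le_lt_trans cq. Qed.

Lemma zero_neq j c : in_tile j c -> zero_row j != i0.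
Proof.
by move=> /vol_gt0; apply: contraTneq => e; rewrite /vol -e zero_rowP.
Qed.

Lemma act_delta j i : act (delta j) i = (i0 == i)%:R - (zero_row j == i)%:R.
Proof.
have e := ie_BA AB i0 (zero_row j) i.
rewrite /act; under eq_bigr => k _ do rewrite /delta mulrBl -!PoszM.
rewrite sumrB -!(big_morph Posz PoszD (erefl _)); lia.
Qed.

Lemma act_lift_back j c i :
  act (lift_back j c) i = vol j * act c i - c j * act (delta j) i.
Proof.
rewrite /act !mulr_sumr -sumrB; apply: eq_bigr => k _.
by rewrite /lift_back mulrBl !mulrA.
Qed.

Lemma lift_back_ge0 j c k : in_tile j c -> 0 <= lift_back j c k.
Proof.
move=> [_ _ h]; rewrite /lift_back; have [->|/h /ltW] := eqVneq k j.
  by rewrite delta_id mulrC subrr.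
by rewrite subr_ge0.
Qed.

Lemma act_ge0 c i : (forall k, 0 <= c k) -> 0 <= act c i.
Proof. by move=> h; apply: sumr_ge0 => k _; rewrite mulr_ge0. Qed.

Lemma proj_ge0 j c i : in_tile j c -> 0 <= proj j c i.
Proof.
move=> h; have q0 := vol_gt0 h; have zi := zero_neq h.
have L k := act_ge0 k (fun k => lift_back_ge0 k h).
rewrite /proj; case: eqP => // /eqP ii0.
rewrite -(pmulr_rge0 _ q0); have := L i; have := L i0.
rewrite !act_lift_back !act_delta eqxx (negPf zi) [i0 == i]eq_sym (negPf ii0).
rewrite [zero_row j == i]eq_sym; case: (i == zero_row j) => /=; lia.
Qed.

Lemma proj_i0 j c : proj j c i0 = 0.
Proof. by rewrite /proj eqxx. Qed.

Lemma projE j c i : in_tile j c ->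
  proj j c i = act c i - act c i0 * ((i0 == i)%:R - (zero_row j == i)%:R).
Proof.
move=> h; have zi := zero_neq h; rewrite /proj [i0 == i]eq_sym [zero_row j == i]eq_sym.
have [->|_] := eqVneq i i0; first by rewrite eq_sym (negPf zi) subr0 mulr1 subrr.
by case: (i == zero_row j) => /=; ring.
Qed.

Lemma sum_pick (F : N -> int) a : \sum_i (a == i)%:R * F i = F a.
Proof.
rewrite (bigD1 a) //= eqxx mul1r big1 ?addr0 // => i /negPf ia.
by rewrite eq_sym ia mul0r.
Qed.

Lemma sum_act c : \sum_i act c i = d%:Z * \sum_k c k.
Proof.
rewrite /act exchange_big mulr_sumr; apply: eq_bigr => k _ /=.
by rewrite -mulr_sumr -(big_morph Posz PoszD (erefl _)) (ie_rowA AB) mulrC.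
Qed.

Lemma sum_proj j c : in_tile j c -> \sum_i proj j c i = (t * d)%N%:Z.
Proof.
move=> h; under eq_bigr => i _ do rewrite projE //.
rewrite sumrB sum_act -mulr_sumr sumrB.
have one a : \sum_i (a == i :> N)%:R = 1 :> int.
  by rewrite -[RHS](sum_pick (fun=> 1) a); apply: eq_bigr => i _; rewrite mulr1.
rewrite !one subrr mulr0 subr0.
by case: h => _ -> _; rewrite PoszM mulrC.
Qed.

Lemma sum_delta j : \sum_k delta j k = 0.
Proof.
rewrite /delta sumrB -!(big_morph Posz PoszD (erefl _)).
by rewrite !(ie_rowB AB) subrr.
Qed.

(** On the facet the point is a combination of the a_k with nonnegative
coefficients of sum t, and each a_k contributes at least 1 to the coordinates
of S; the projection removes the coordinate i0, which is not in S, and adds it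
to another one. *)
Lemma proj_hit j c : in_tile j c -> t%:Z <= \sum_(i in S) proj j c i.
Proof.
move=> h; have q0 := vol_gt0 h.
rewrite -(ler_pM2l q0).
have sumL : \sum_k lift_back j c k = vol j * t%:Z.
  rewrite /lift_back sumrB -!mulr_sumr; case: (h) => _ -> _.
  by rewrite sum_delta mulr0 subr0.
rewrite -sumL mulr_sumr.
apply: le_trans (_ : \sum_(i in S) act (lift_back j c) i <= _).
  rewrite /act exchange_big /=; apply: ler_sum => k _; rewrite -mulr_sumr.
  rewrite -{1}[lift_back j c k]mulr1 ler_wpM2l ?lift_back_ge0 //.
  by rewrite -(big_morph Posz PoszD (erefl _)); exact: hitS.
apply: ler_sum => i iS.
have ii0 : i != i0 by apply: contraNneq i0S => <-.
rewrite act_lift_back act_delta /proj (negPf ii0) [i0 == i]eq_sym (negPf ii0).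
have := act_ge0 i0 (fun k => lift_back_ge0 k h).
rewrite act_lift_back act_delta eqxx (negPf (zero_neq h)) [zero_row j == i]eq_sym.
case: (i == zero_row j) => /=; lia.
Qed.

Definition lam m : int := (\sum_k A ord0 k * B k m)%N%:Z - (ord0 == m :> N)%:R.

Lemma lamE i m : (\sum_k A i k * B k m)%N%:Z = lam m + (i == m)%:R.
Proof. by have := ie_AB AB i ord0 m; rewrite /lam; lia. Qed.

(** Multiplication by B recovers the coefficients, up to a shift by t lam that
is common to all tiles. *)
Lemma unproj j c m : in_tile j c ->
  \sum_i proj j c i * (B i m)%:Z = c m + t%:Z * lam m - act c i0 * delta j m.
Proof.
move=> h; under eq_bigr => i _ do rewrite projE // mulrBl -mulrA mulrBl.
rewrite sumrB -mulr_sumr sumrB !sum_pick; congr (_ - _ * _).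
rewrite /act; under eq_bigr => i _ do rewrite mulr_suml.
rewrite exchange_big /=.
transitivity (\sum_k c k * (lam m + (k == m)%:R)).
  apply: eq_bigr => k _; rewrite -lamE (big_morph Posz PoszD (erefl _)) mulr_sumr.
  by apply: eq_bigr => i _; rewrite PoszM mulrA.
under eq_bigr => k _ do rewrite mulrDr.
rewrite big_split /= -mulr_suml addrC; case: h => _ -> _; congr (_ + _).
rewrite (bigD1 m) //= eqxx mulr1 big1 ?addr0 // => k /negPf km.
by rewrite km mulr0.
Qed.

(* u j c = vol times the length *)
Definition height j c : int := vol j * act c i0 - c j.

Lemma height_ge0 j c : in_tile j c -> 0 <= height j c.
Proof.
move=> h; have := act_ge0 i0 (fun k => lift_back_ge0 k h).
by rewrite act_lift_back act_delta eqxx (negPf (zero_neq h)) subr0 mulr1.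
Qed.

(** Compare the j-th coefficients of the common projection. Computed from the
j-th facet, where the j-th coefficient vanishes, it is -height j c. Computed
from the l-th facet, in whose interior the j-th coefficient is positive, it is
greater than -height l c' (vol j / vol l). *)
Lemma height_lt j l c c' : j != l -> in_tile j c -> in_tile l c' ->
  (forall i, proj j c i = proj l c' i) -> vol l * height j c < vol j * height l c'.
Proof.
move=> jl h h' e.
have E m : c m - act c i0 * delta j m = c' m - act c' i0 * delta l m.
  apply: (addIr (t%:Z * lam m)); rewrite ![_ - _ + _]addrAC -!unproj //.
  by apply: eq_bigr => i _; rewrite e.
have := E j; rewrite delta_id => Ej.
have g0 := height_ge0 h'.
case: (h') => _ _ /(_ j jl) hj.
have dl : delta l j <= vol j by rewrite /delta /vol; lia.
have := ler_wpM2l g0 dl.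
rewrite /height in g0 *.
have -> : vol l * (vol j * act c i0 - c j) = - (vol l * (c j - act c i0 * vol j)) by ring.
rewrite Ej; lia.
Qed.

(** Two different tiles would be strictly above each other. *)
Lemma proj_inj j l c c' : in_tile j c -> in_tile l c' ->
  (forall i, proj j c i = proj l c' i) -> j = l /\ forall k, c k = c' k.
Proof.
move=> h h' e; have [jl|jl] := eqVneq j l; last first.
  have h1 := height_lt jl h h' e; rewrite eq_sym in jl.
  have := height_lt jl h' h (fun i => esym (e i)).
  by move/(lt_trans h1); rewrite ltxx.
split=> //; subst l.
have q0 := vol_gt0 h.
have E m : c m - act c i0 * delta j m = c' m - act c' i0 * delta j m.
  apply: (addIr (t%:Z * lam m)); rewrite ![_ - _ + _]addrAC -!unproj //.
  by apply: eq_bigr => i _; rewrite e.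
have := E j; rewrite delta_id => Ej.
case: (h) => /andP[c0 cq] _ _; case: (h') => /andP[c0' cq'] _ _.
have ea : act c i0 = act c' i0 by nia.
by move=> k; have := E k; rewrite ea; lia.
Qed.

Hypothesis d_gt0 : (0 < d)%N.
Let T := (t * d)%N.
Let Pt := {ffun N -> 'I_T.+1}.

(** A point of the dilated tile is built from a residue r < vol j and a
composition w of t - n: the k-th coefficient has to exceed r delta_k / vol j,
so [min_coord] is its least value, and what is missing to reach the sum t is
added to one coefficient different from the j-th. *)
Definition min_coord j (r : nat) k : int := ((r%:Z * delta j k) %/ vol j)%Z + 1.
Definition slack j (r : nat) : int := n%:Z - r%:Z - \sum_(k | k != j) min_coord j r k.
Definition other_index (j : N) : N := if j == ord0 then ord_max else ord0.
Definition coord j (r : nat) (w : Pt) k : int :=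
  if k == j then r%:Z
  else min_coord j r k + (w k)%:Z + (if k == other_index j then slack j r else 0).

Lemma other_index_neq j : other_index j != j.
Proof.
rewrite /other_index; have [->|/negPf] := eqVneq j ord0; last by rewrite eq_sym => ->.
by rewrite -val_eqE /= -lt0n.
Qed.

Lemma slack_ge0 j r : (r < B i0 j)%N -> 0 <= slack j r.
Proof.
move=> rq; have q0 : 0 < vol j by rewrite /vol; lia.
have := sum_delta j; rewrite (bigD1 j) //= delta_id => sd.
have card : \sum_(k | k != j) 1 = n%:Z.
  by rewrite sumr_const cardC1 card_ord /= natz.
have : vol j * \sum_(k | k != j) (min_coord j r k - 1) <= \sum_(k | k != j) (r%:Z * delta j k).
  rewrite mulr_sumr; apply: ler_sum => k _; rewrite /min_coord addrK mulrC.
  by apply: lez_floor; rewrite gt_eqF.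
rewrite -mulr_sumr sumrB card.
have -> : \sum_(k | k != j) delta j k = - vol j.
  by apply/eqP; rewrite -addr_eq0 addrC sd.
rewrite mulrN mulrC -mulNr ler_pM2r //; rewrite /slack.
by move: (\sum_(i | _) _) => X; clear; lia.
Qed.

Lemma coord_in_tile j r (w : Pt) : (r < B i0 j)%N ->
  w \in comps T (~: [set j]) (t - n) -> in_tile j (coord j r w).
Proof.
move=> rq /compsP[w0 wsum]; have s0 := slack_ge0 rq.
have q0 : 0 < vol j by rewrite /vol; lia.
split.
- by rewrite /coord eqxx /vol; lia.
- rewrite (bigD1 j) //= {1}/coord eqxx.
  transitivity (r%:Z + \sum_(k | k != j)
     (min_coord j r k + (w k)%:Z + (if k == other_index j then slack j r else 0))).
    by congr (_ + _); apply: eq_bigr => k /negPf kj; rewrite /coord kj.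
  rewrite 2!big_split /=.
  have -> : \sum_(k | k != j) (if k == other_index j then slack j r else 0) = slack j r.
    rewrite (bigD1 (other_index j)) ?other_index_neq //= eqxx big1 ?addr0 // => k.
    by case/andP=> _ /negPf ->.
  have -> : \sum_(k | k != j) (w k)%:Z = (t - n)%N%:Z.
    rewrite -wsum [in RHS](bigD1 j) //= w0 ?add0n ?(big_morph Posz PoszD (erefl _)) //.
    by rewrite !inE eqxx.
  have := subnK le_nt; rewrite /slack; move: (\sum_(i | _) _) (t - n)%N => X m.
  clear; lia.
- move=> k kj; rewrite /coord eqxx (negPf kj).
  apply: lt_le_trans (ltz_ceil (r%:Z * delta j k) q0) _.
  rewrite -/(min_coord j r k) mulrC ler_pM2l // -addrA lerDl.
  by case: ifP => _; lia.
Qed.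

Lemma coord_inj j r (w w' : Pt) :
  w \in comps T (~: [set j]) (t - n) -> w' \in comps T (~: [set j]) (t - n) ->
  (forall k, coord j r w k = coord j r w' k) -> w = w'.
Proof.
move=> /compsP[w0 _] /compsP[w0' _] e; apply/ffunP => k; apply: val_inj => /=.
have := e k; rewrite /coord; have [->|_] := eqVneq k j; last by move=> /addIr/addrI[].
by rewrite w0 ?w0' // !inE eqxx.
Qed.

Definition point j r (w : Pt) : Pt := [ffun i => inord `|proj j (coord j r w) i|%N].

Lemma pointE j r (w : Pt) i : in_tile j (coord j r w) ->
  (point j r w i)%:Z = proj j (coord j r w) i.
Proof.
move=> h; have p0 k := proj_ge0 k h.
rewrite ffunE inordK; first by rewrite gez0_abs.
rewrite ltnS -lez_nat gez0_abs // -(sum_proj h) (bigD1 i) //= lerDl.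
exact: sumr_ge0.
Qed.

(** The lattice points of the t-fold dilated simplex outside the corner. *)
Definition upper : {set Pt} :=
  [set p in comps T (~: [set i0]) T | (t <= \sum_(i in S) p i)%N].

Lemma point_upper j r (w : Pt) : in_tile j (coord j r w) -> point j r w \in upper.
Proof.
move=> h; have E i := pointE i h.
rewrite inE; apply/andP; split.
  apply/compsP; split=> [i|].
    rewrite !inE negbK => /eqP ->; apply/eqP; rewrite -eqz_nat E.
    by rewrite proj_i0.
  apply/eqP; rewrite -eqz_nat (big_morph Posz PoszD (erefl _)).
  by under eq_bigr => i _ do rewrite E; rewrite sum_proj.
rewrite -lez_nat (big_morph Posz PoszD (erefl _)).
by under eq_bigr => i _ do rewrite E; exact: proj_hit.
Qed.

(** Each of the vol j residues contributes 'C(t-1, n-1) points of the j-th tile,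
and the volumes have sum D. *)
Lemma tiles_le_upper : (D * 'C(t - 1, n - 1) <= #|upper|)%N.
Proof.
pose dom := [set x : N * 'I_D.+1 * Pt |
  (x.1.2 < B i0 x.1.1)%N && (x.2 \in comps T (~: [set x.1.1]) (t - n))].
have -> : (D * 'C(t - 1, n - 1) = #|dom|)%N.
  rewrite -sum1dep_card -(pair_big_dep (fun y : N * 'I_D.+1 => (y.2 < B i0 y.1)%N)
    (fun y w => w \in comps T (~: [set y.1]) (t - n)) (fun _ _ => 1%N)) /=.
  under eq_bigr => y _.
    rewrite sum1_card card_comps; last 2 first.
    - by rewrite cardsC1 card_ord.
    - by rewrite /T; nia.
    rewrite cardsC1 card_ord /=.
    over.
  rewrite -(pair_big_dep xpredT (fun (j : N) (r : 'I_D.+1) => (r < B i0 j)%N)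
     (fun _ _ => 'C(n.-1 + (t - n), n.-1))) /=.
  under eq_bigr => j _.
    have le : (B i0 j <= D.+1)%N.
      by rewrite leqW // -(ie_rowB AB i0) (bigD1 j) //= leq_addr.
    rewrite (big_ord_narrow le) sum_nat_const card_ord.
    over.
  rewrite -big_distrl /= (ie_rowB AB) subn1; congr (_ * 'C(_, _))%N.
    by lia.
  by rewrite subn1.
pose f (x : N * 'I_D.+1 * Pt) := point x.1.1 x.1.2 x.2.
rewrite -(card_in_imset (f := f)); last first.
  move=> [[j r] w] [[l r'] w']; rewrite ![_ \in dom]inE /f /= => /andP[rq wc] /andP[rq' wc'] e.
  have h := coord_in_tile rq wc; have h' := coord_in_tile rq' wc'.
  have ep i : proj j (coord j r w) i = proj l (coord l r' w') i.
    by rewrite -!pointE // e.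
  have [jl cc] := proj_inj h h' ep; subst l.
  have rr : r = r'.
    by apply: val_inj; have := cc j; rewrite /coord eqxx => -[].
  subst r'; by rewrite (coord_inj wc wc' cc).
apply/subset_leq_card/subsetP => p /imsetP[[[j r] w]]; rewrite inE /= => /andP[rq wc] ->.
exact: point_upper (coord_in_tile rq wc).
Qed.

Lemma upper_le : (#|upper| <= 'C(n - 1 + t * d, n - 1))%N.
Proof.
have -> : 'C(n - 1 + t * d, n - 1) = #|comps T (~: [set i0]) T|.
  by rewrite card_comps // cardsC1 card_ord //= subn1.
by apply/subset_leq_card/subsetP => p; rewrite inE => /andP[].
Qed.

(** Sums f + g with f a composition of t - 1 indexed by S and one more variable
i1, and g a composition of the rest t d - t + 1 indexed by the variables
outside S: f is determined by its values on S, so f + g determines f and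
g. *)
Lemma upper_cut : (#|S| < n)%N ->
  (#|upper| + 'C(#|S| + (t - 1), #|S|) *
     'C(n - 1 - #|S| + (t * d - t + 1), n - 1 - #|S|) <= 'C(n - 1 + t * d, n - 1))%N.
Proof.
move=> Sn; set R := ~: (i0 |: S).
have cR : #|R| = (n - #|S|)%N.
  by rewrite /R cardsCs setCK card_ord cardsU1 i0S.
have [i1 i1R] : exists i1, i1 \in R by apply/card_gt0P; rewrite cR subn_gt0.
have i1S : i1 \notin S by move: i1R; rewrite !inE negb_or => /andP[].
have t0 : (0 < t)%N by apply: leq_trans le_nt.
have td : (t <= t * d)%N by rewrite leq_pmulr.
pose C := [set p in comps T (~: [set i0]) T | (\sum_(i in S) p i < t)%N].
have -> : 'C(n - 1 + t * d, n - 1) = (#|upper| + #|C|)%N.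
  rewrite -cardsUI (_ : upper :&: C = set0); last first.
    by apply/setP => p; rewrite !inE; case: leqP => _; rewrite !andbF.
  rewrite cards0 addn0 (_ : upper :|: C = comps T (~: [set i0]) T).
    by rewrite card_comps // cardsC1 card_ord //= subn1.
  by apply/setP => p; rewrite !inE -andb_orr; case: leqP; rewrite andbT.
rewrite leq_add2l.
pose F := comps T (i1 |: S) (t - 1); pose G := comps T R (t * d - t + 1).
have cF : #|F| = 'C(#|S| + (t - 1), #|S|).
  by rewrite card_comps ?cardsU1 ?i1S //=; rewrite /T; lia.
have cG : #|G| = 'C(n - 1 - #|S| + (t * d - t + 1), n - 1 - #|S|).
  have e : (#|R|.-1 = n - 1 - #|S|)%N by rewrite cR; lia.
  by rewrite card_comps ?e ?cR ?subn_gt0 //; rewrite /T; lia.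
rewrite -cF -cG -cardsX.
pose h (x : Pt * Pt) : Pt := [ffun i => inord (x.1 i + x.2 i)%N].
have hE x i : x \in setX F G -> h x i = (x.1 i + x.2 i)%N :> nat.
  case: x => f g; rewrite in_setX /= => /andP[/compsP[_ e1] /compsP[_ e2]].
  rewrite ffunE inordK //.
  have : (f i <= t - 1)%N by rewrite -e1 (bigD1 i) //= leq_addr.
  have : (g i <= t * d - t + 1)%N by rewrite -e2 (bigD1 i) //= leq_addr.
  rewrite /T ltnS /=; move: (f i : nat) (g i : nat) => a b; clear -t0 td; lia.
have sumS (f : Pt) : f \in F -> (f i1 + \sum_(i in S) f i = t - 1)%N.
  case/compsP=> f0 <-; rewrite [RHS](bigID (mem (i1 |: S))) /=.
  by rewrite [X in _ = (_ + X)%N]big1 ?addn0 ?big_setU1 // => i iS; rewrite f0.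
rewrite -(card_in_imset (f := h)); last first.
  move=> [f g] [f' g'] X X' e.
  have E i : (f i + g i = f' i + g' i)%N.
    by rewrite -(hE _ i X) e (hE _ i X').
  move: X X'; rewrite !in_setX /= => /andP[fF gG] /andP[fF' gG'].
  have /compsP[f0 _] := fF; have /compsP[f0' _] := fF'.
  have /compsP[g0 _] := gG; have /compsP[g0' _] := gG'.
  have fS i : i \in S -> f i = f' i :> nat.
    move=> iS; have := E i; rewrite g0 ?g0' ?addn0 //; by rewrite !inE iS orbT.
  have ff : f = f'.
    apply/ffunP => i; apply: val_inj => /=.
    have [iS|iS] := boolP (i \in i1 |: S); last by rewrite f0 // f0'.
    move: iS; rewrite !inE => /orP[/eqP ->|/fS //].
    have es : (\sum_(i in S) f i = \sum_(i in S) f' i)%N by apply: eq_bigr.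
    by have := sumS _ fF; rewrite es -(sumS _ fF') => /addIn.
  congr (_, _) => //; apply/ffunP => i; apply: val_inj => /=.
  by have := E i; rewrite ff => /addnI.
apply/subset_leq_card/subsetP => p /imsetP[[f g] X ->].
have E i := hE _ i X; move: X; rewrite in_setX /= => /andP[fF gG].
have /compsP[f0 fs] := fF; have /compsP[g0 gs] := gG.
rewrite inE.
have i1i0 : i1 != i0 by move: i1R; rewrite !inE negb_or => /andP[].
apply/andP; split.
  apply/compsP; split=> [i|].
    rewrite !inE negbK => /eqP ->; rewrite E f0 ?g0 //=.
      by rewrite !inE eqxx.
    by rewrite !inE negb_or eq_sym i1i0.
  under eq_bigr => i _ do rewrite E.
  by rewrite big_split /= fs gs /T; lia.
rewrite (eq_bigr (fun i => nat_of_ord (f i))) => [|i iS].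
  by rewrite (leq_ltn_trans (leq_addl (f i1) _)) // sumS // subn1 ltn_predL.
by rewrite E g0 ?addn0 // !inE iS orbT.
Qed.

End Tiles.

(** * Inequalities between numbers of lattice points *)

Section LatticePointInequalities.
Local Open Scope nat_scope.

Lemma expn_le_ffact m k : (m.+1 - k) ^ k <= m ^_ k.
Proof.
rewrite ffact_prod -[X in _ ^ X](card_ord k) -prod_nat_const.
by apply: leq_prod => i _; have := ltn_ord i; lia.
Qed.

Lemma ffact_le_expn m k : m ^_ k <= m ^ k.
Proof.
rewrite ffact_prod -[X in _ ^ X](card_ord k) -prod_nat_const.
by apply: leq_prod => i _; rewrite leq_subr.
Qed.

Lemma leq_expl m n e : m <= n -> m ^ e <= n ^ e.
Proof. by case: e => // e; rewrite leq_exp2r. Qed.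

Section Count.
Variables (n d D : nat) (A B : 'I_n.+1 -> 'I_n.+1 -> nat).
Hypothesis AB : inverse_exponents d D A B.
Variables (S : {set 'I_n.+1}).
Hypothesis hitS : forall k, (0 < \sum_(j in S) A k j)%N.
Hypothesis d_gt0 : 0 < d.

Lemma avoid_coordinate : #|S| <= n -> exists i0, i0 \notin S.
Proof.
move=> Sn; have [i0] : exists i0, i0 \in ~: S.
  by apply/card_gt0P; rewrite cardsCs setCK card_ord subn_gt0.
by rewrite inE; exists i0.
Qed.

(** The number of lattice points, multiplied by (n-1)! and with falling factorials
replaced by powers. *)
Lemma count_all t : #|S| <= n -> 0 < n <= t ->
  D * (t - n) ^ (n - 1) <= (t * d + n) ^ (n - 1).
Proof.
move=> Sn /andP[n0 nt]; have [i0 i0S] := avoid_coordinate Sn.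
have le1 := tiles_le_upper AB i0S hitS n0 nt d_gt0.
have := leq_trans le1 (upper_le _ _ _ _ n0).
rewrite -(leq_pmul2r (fact_gt0 (n - 1))) -mulnA !bin_ffact => h.
apply: leq_trans (leq_trans h _).
  rewrite leq_mul2l; apply/orP; right.
  by apply: leq_trans (expn_le_ffact _ _); apply: leq_expl; lia.
by apply: leq_trans (ffact_le_expn _ _) _; apply: leq_expl; lia.
Qed.

Lemma count_cut t (K := 'C(n - 1, #|S|) * (d - 1) ^ (n - 1 - #|S|)) :
  #|S| < n -> 0 < n <= t ->
  D * (t - n) ^ (n - 1) + K * t ^ (n - 1) <= (t * d + n) ^ (n - 1).
Proof.
move=> Sn /andP[n0 nt]; have [i0 i0S] := avoid_coordinate (ltnW Sn).
have le1 := tiles_le_upper AB i0S hitS n0 nt d_gt0.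
have le2 := upper_cut i0S n0 nt d_gt0 Sn.
set c := #|S| in K Sn le2 *; set e := n - 1 - c in K le2 *.
have ce : n - 1 = c + e by rewrite /e; lia.
have := leq_trans (leq_add le1 (leqnn _)) le2.
rewrite -(leq_pmul2r (fact_gt0 (n - 1))) mulnDl -mulnA !bin_ffact => h.
apply: leq_trans (leq_trans h _); last first.
  by apply: leq_trans (ffact_le_expn _ _) _; apply: leq_expl; lia.
apply: leq_add.
  rewrite leq_mul2l; apply/orP; right.
  by apply: leq_trans (expn_le_ffact _ _); apply: leq_expl; lia.
have cn : c <= n - 1 by lia.
rewrite -(bin_fact cn) -/e.
rewrite (_ : _ * _ * _ = 'C(n - 1, c) * (('C(c + (t - 1), c) * c`!) *
                            ('C(e + (t * d - t + 1), e) * e`!))); last by ring.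
rewrite !bin_ffact /K -mulnA leq_mul2l; apply/orP; right.
rewrite ce expnD mulnCA -expnMn; apply: leq_mul.
  by apply: leq_trans (expn_le_ffact _ _); apply: leq_expl; lia.
apply: leq_trans (expn_le_ffact _ _); apply: leq_expl.
by rewrite mulnC mulnBr muln1; lia.
Qed.

End Count.

Lemma two_pow_le_bin c e : 2 < c -> 0 < e <= c -> 2 * 2 ^ e <= 'C(c + e, e).
Proof.
move=> c2; elim: e => // -[_ _|e IH /andP[_ ec]].
  by rewrite addn1 bin1; lia.
have {IH} IH : 2 * 2 ^ e.+1 <= 'C(c + e.+1, e.+1) by apply: IH; lia.
rewrite -(leq_pmul2l (ltn0Sn e.+1)) -mul_bin_diag addnS /=.
rewrite expnS mulnCA mulnA; apply: leq_mul => //; lia.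
Qed.

(** The corner is large enough for exponents up to 2. *)
Lemma two_pow_le_cut d c e : 1 < d -> 2 < c -> 0 < e <= c ->
  2 * d ^ e <= 'C(c + e, c) * (d - 1) ^ e.
Proof.
move=> d1 c2 ec; rewrite -{2}(addnK e c) bin_sub ?leq_addl //.
apply: leq_trans (leq_mul (two_pow_le_bin c2 ec) (leqnn _)).
rewrite -mulnA -expnMn leq_mul2l /=; apply: leq_expl; lia.
Qed.

End LatticePointInequalities.

(** * Passage to the limit and real powers *)

From mathcomp Require Import all_classical all_reals all_analysis.
Import numFieldNormedType.Exports.
Local Open Scope classical_set_scope.
Local Open Scope ring_scope.

Section Analysis.
Variable R : realType.
Implicit Types (x y e s : R).

(** Divide by t^k and let t tend to infinity: the polynomial p in s = 1/t below
is nonnegative at the points of a sequence tending to 0. *)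
Lemma leading_coefficient_le (n k a b d : nat) :
  (forall t, (n <= t)%N -> (a * (t - n) ^ k + b * t ^ k <= (t * d + n) ^ k)%N) ->
  (a + b <= d ^ k)%N.
Proof.
move=> h; pose p : {poly R} :=
  (d%:R%:P + n%:R *: 'X) ^+ k - (a%:R *: (1 - n%:R *: 'X) ^+ k + b%:R%:P).
have pE s : p.[s] = (d%:R + n%:R * s) ^+ k - (a%:R * (1 - n%:R * s) ^+ k + b%:R).
  by rewrite /p !hornerE.
have p0 : p.[0] = (d ^ k)%:R - (a + b)%:R.
  by rewrite pE !mulr0 addr0 subr0 expr1n mulr1 natrD natrX.
have cvgp : p.[harmonic m] @[m --> \oo] --> p.[0].
  by apply: continuous_cvg; [exact: continuous_horner|exact: cvg_harmonic].
suff : 0 <= p.[0] by rewrite p0 subr_ge0 ler_nat.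
apply: (cvgr_to_ge cvgp); near=> m.
have nm : (n <= m)%N by near: m; exact: nbhs_infty_ge.
have m0 : 0 < m.+1%:R :> R by rewrite ltr0n.
have mk : 0 < m.+1%:R ^+ k :> R by rewrite exprn_gt0.
have m1 : m.+1%:R != 0 :> R by rewrite gt_eqF.
rewrite -(pmulr_rge0 _ mk) pE /harmonic /=.
have -> : d%:R + n%:R * m.+1%:R^-1 = (m.+1%:R * d%:R + n%:R) / m.+1%:R :> R.
  by field.
have -> : 1 - n%:R * m.+1%:R^-1 = (m.+1%:R - n%:R) / m.+1%:R :> R by field.
have cancel (z : R) : m.+1%:R ^+ k * (z / m.+1%:R ^+ k) = z.
  by rewrite mulrC divfK // gt_eqF.
rewrite !expr_div_n mulrBr cancel mulrDr mulrCA cancel [_ * b%:R]mulrC subr_ge0.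
have := h m.+1 (leqW nm); rewrite -(ler_nat R) natrD !natrM !natrX natrD natrM.
by rewrite natrB // leqW.
Unshelve. all: by end_near. Qed.

(** With L the right-hand side, add the inequalities ln z <= z - 1 at z = y / L and
z = 1 / L with weights e and 1 - e. *)
Lemma powR_le_tangent y e : 0 < y -> 0 <= e <= 1 -> y `^ e <= 1 + e * (y - 1).
Proof.
move=> y0 /andP[e0 e1]; set L := 1 + e * (y - 1).
have L0 : 0 < L.
  rewrite /L; have [y1|y1] := leP 1 y; first by nra.
  nra.
have ln_le (z : R) : 0 < z -> ln z <= z - 1.
  by move=> z0; have := expR_ge1Dx (ln z); rewrite lnK ?posrE //; lra.
rewrite /powR gt_eqF // -[leRHS](lnK (x := L)) ?posrE // ler_expR.
have h1 := ln_le (y / L) (divr_gt0 y0 L0).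
have h2 := ln_le (1 / L) (divr_gt0 ltr01 L0).
rewrite ln_div ?posrE // in h1; rewrite ln_div ?posrE // ln1 in h2.
have e1' : 0 <= 1 - e by lra.
have := lerD (ler_wpM2l e0 h1) (ler_wpM2l e1' h2).
have -> : e * (y / L - 1) + (1 - e) * (1 / L - 1) = 0.
  rewrite /L; field; exact: lt0r_neq0.
lra.
Qed.

(** The upper bound is the tangent bound for the exponent e - 1, multiplied by
1 - x. The lower bound is the tangent bound for the exponent 2 - e, since the
powers with exponents e and 2 - e have product (1 - x)^2. *)
Lemma powR_taylor x e : 0 <= x < 1 -> 1 <= e <= 2 ->
  `|(1 - x) `^ e - (1 - e * x)| <= x ^+ 2.
Proof.
move=> /andP[x0 x1] /andP[e1 e2].
have y0 : 0 < 1 - x by lra.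
have y1 : 1 - x != 0 by rewrite gt_eqF.
have up : (1 - x) `^ (e - 1) <= 1 + (e - 1) * ((1 - x) - 1).
  by apply: powR_le_tangent => //; lra.
have lo : (1 - x) `^ (2 - e) <= 1 + (2 - e) * ((1 - x) - 1).
  by apply: powR_le_tangent => //; lra.
have E1 : (1 - x) `^ e = (1 - x) * (1 - x) `^ (e - 1).
  rewrite -{2}(powRr1 (ltW y0)) -powRD ?y1 ?implybT //.
  by congr (_ `^ _); ring.
have E2 : (1 - x) `^ e * (1 - x) `^ (2 - e) = (1 - x) ^+ 2.
  rewrite -powRD ?y1 ?implybT // -(powR_mulrn 2 (ltW y0)).
  by congr (_ `^ _); ring.
have p0 : 0 <= (1 - x) `^ e := powR_ge0 _ _.
have U : (1 - x) `^ e <= (1 - x) * (1 + (e - 1) * (1 - x - 1)).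
  by rewrite E1 ler_pM2l.
have L : (1 - e * x) * (1 - (2 - e) * x) <= (1 - x) `^ e * (1 - (2 - e) * x).
  apply: le_trans (_ : (1 - x) ^+ 2 <= _).
    have : e * (2 - e) <= 1 by nra.
    have : 0 <= x ^+ 2 by rewrite sqr_ge0.
    nra.
  rewrite -E2; apply: ler_wpM2l => //; lra.
rewrite ler_pM2r in L; last by nra.
rewrite ger0_norm ?subr_ge0 //; nra.
Qed.

End Analysis.

(** * The degree of the inverse *)

Section DegreeBound.
Variables (R : realType) (n d D : nat) (A B : 'I_n.+1 -> 'I_n.+1 -> nat).
Hypotheses (AB : inverse_exponents d D A B) (d_gt1 : (1 < d)%N) (n_ge2 : (2 <= n)%N).
Let c := (n %/ 2 + 1)%N.

Lemma degree_le : (D <= d ^ (n - 1))%N.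
Proof.
have [S [Sc hit]] := hitting_set d_gt1 AB.
rewrite -[D]addn0; apply: (@leading_coefficient_le R n) => t nt.
rewrite mul0n addn0; by apply: (count_all AB hit); rewrite ?Sc; lia.
Qed.

Lemma degree_cut_le : (3 <= n)%N ->
  (D + 'C(n - 1, c) * (d - 1) ^ (n - 1 - c) <= d ^ (n - 1))%N.
Proof.
move=> n3; have [S [Sc hit]] := hitting_set d_gt1 AB.
have Sc' : #|S| = c by rewrite Sc /c addn1.
apply: (@leading_coefficient_le R n) => t nt; rewrite -Sc'.
by apply: (count_cut AB hit); rewrite ?Sc' /c; lia.
Qed.

(** For n = 2 the exponent is 0, for n = 3 and n = 4 it is 1 and the corner is a
single unit simplex, and for n >= 5 it is at most 2, so that Bernoulli's
inequality for squares suffices. *)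
Lemma degree_le_bound :
  D%:R <= (1 - d%:R ^- c) `^ ((n%:R - 2) / (c%:R - 1)) * d%:R ^+ (n - 1) :> R.
Proof.
have d0 : 0 < d%:R :> R by rewrite ltr0n; lia.
have cE : c%:R - 1 = (n %/ 2)%:R :> R by rewrite /c natrD addrK.
have half := divn_eq n 2; have hmod := ltn_pmod n (isT : (0 < 2)%N).
have h0 : 0 < (n %/ 2)%:R :> R by rewrite ltr0n; lia.
have x0 : 0 < d%:R ^- c :> R by rewrite invr_gt0 exprn_gt0.
have x1 : d%:R ^- c < 1 :> R.
  by rewrite invf_lt1 ?exprn_gt0 // exprn_egt1 ?ltr1n // /c addn1.
have y_ge0 : 0 <= 1 - d%:R ^- c :> R by rewrite subr_ge0 ltW.
have [n2|n3] := ltnP n 3.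
  have -> : n = 2%N by lia.
  rewrite subrr mul0r powRr0 mul1r -natrX ler_nat.
  by have := degree_le; rewrite (_ : n = 2%N) //; lia.
have cn : (c <= n - 1)%N by rewrite /c; lia.
have xd : d%:R ^- c * d%:R ^+ (n - 1) = (d ^ (n - 1 - c))%:R :> R.
  by rewrite natrX -[in LHS](subnK cn) exprD mulrCA mulVf ?mulr1 // expf_neq0 ?gt_eqF.
have main := degree_cut_le n3.
have [n5|n5] := leqP 5 n; last first.
  have -> : (n%:R - 2) / (c%:R - 1) = 1 :> R.
    have nE : n%:R = (n %/ 2)%:R + 2 :> R by rewrite -natrD; congr _%:R; lia.
    by rewrite cE nE addrK divff // gt_eqF.
  rewrite powRr1 // mulrBl mul1r xd -natrX lerBrDr -natrD ler_nat.
  have cc : (n - 1 = c)%N by rewrite /c; lia.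
  by move: main; rewrite cc binn subnn !expn0.
apply: le_trans (_ : (1 - d%:R ^- c) `^ 2%:R * d%:R ^+ (n - 1) <= _); last first.
  rewrite ler_pM2r ?exprn_gt0 //; apply: ger_powR.
    by rewrite subr_gt0 x1 lerBlDr lerDl (ltW x0).
  rewrite cE ler_pdivrMr // lerBlDr -natrM -natrD ler_nat; lia.
apply: le_trans (_ : (1 - 2 * d%:R ^- c) * d%:R ^+ (n - 1) <= _); last first.
  rewrite ler_pM2r ?exprn_gt0 // powR_mulrn //.
  by have := sqr_ge0 (d%:R ^- c : R); nra.
rewrite mulrBl mul1r -mulrA xd -natrX -natrM lerBrDr -natrD ler_nat.
apply: leq_trans main; rewrite leq_add2l.
have -> : 'C(n - 1, c) = 'C(c + (n - 1 - c), c) by rewrite subnKC.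
by apply: two_pow_le_cut => //; rewrite /c; lia.
Qed.

End DegreeBound.

Theorem mainTheorem3 (R : realType) (n : nat) (hn : (2 <= n)%N) :
  let c := (n %/ 2 + 1)%N in
  let bound : nat -> R := fun d =>
    (1 - d%:R ^- c) `^ ((n%:R - 2) / (c%:R - 1)) * d%:R ^+ (n - 1) in
  (forall (k : fieldType) (d : nat) (f : ratmap k n),
      (2 <= d)%N -> monomial_map d f -> birational f ->
      forall g : ratmap k n, rat_inverse f g -> (rat_deg g)%:R <= bound d) /\
  bound = (fun d : nat => d%:R ^+ (n - 1)
             - (n%:R - 2) / (n %/ 2)%:R * d%:R ^ ((n%:Z - 3) %/ 2)%Z)
          +O_\oo (fun d : nat => d%:R ^- 2 : R).
Proof.
move=> c bound; split.
  move=> k d f d2 [a [rowa _ fa]] _ g fg.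
  have [B AB] := MonomialInverse.monomial_inverse (ltnW d2) rowa fa fg.
  exact: degree_le_bound AB d2 hn.
have half := divn_eq n 2; have hmod := ltn_pmod n (isT : (0 < 2)%N).
have h0 : 0 < (n %/ 2)%:R :> R by rewrite ltr0n; lia.
have cE : c%:R - 1 = (n %/ 2)%:R :> R by rewrite /c natrD addrK.
apply/eqaddOP; near=> K; near=> d.
have d2 : (2 <= d)%N by near: d; exact: nbhs_infty_ge.
have K1 : 1 <= K by near: K; exact: nbhs_pinfty_ge.
have d0 : 0 < d%:R :> R by rewrite ltr0n; lia.
have dn0 : d%:R != 0 :> R by rewrite gt_eqF.
set e := (n%:R - 2) / (n %/ 2)%:R; set x : R := d%:R ^- c.
have x0 : 0 < x by rewrite invr_gt0 exprn_gt0.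
have x1 : x < 1.
  by rewrite invf_lt1 ?exprn_gt0 // exprn_egt1 ?ltr1n // /c addn1.
have zE : d%:R ^ ((n%:Z - 3) %/ 2)%Z = x * d%:R ^+ (n - 1) :> R.
  have -> : ((n%:Z - 3) %/ 2)%Z = (n - 1)%N%:Z - c%:Z by rewrite /c; lia.
  by rewrite expfzDr // mulrC /x exprnN.
have taylor : `|(1 - x) `^ e - (1 - e * x)| <= x ^+ 2.
  have [n3|n3] := ltnP n 3.
    have e0 : e = 0 by rewrite /e (_ : n = 2%N) ?subrr ?mul0r //; lia.
    by rewrite e0 powRr0 mul0r subr0 subrr normr0 sqr_ge0.
  apply: powR_taylor; first by rewrite ltW.
  rewrite /e ler_pdivlMr // ler_pdivrMr // mul1r lerBrDr lerBlDr.
  rewrite -natrM -!natrD !ler_nat; lia.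
rewrite /= /bound !fctE cE -/e -/x zE.
have -> : (1 - x) `^ e * d%:R ^+ (n - 1) -
    (d%:R ^+ (n - 1) - e * (x * d%:R ^+ (n - 1))) =
    ((1 - x) `^ e - (1 - e * x)) * d%:R ^+ (n - 1) by ring.
rewrite normrM [`|d%:R ^+ _|]ger0_norm ?exprn_ge0 ?ler0n //.
rewrite [`|d%:R ^- 2|]ger0_norm ?invr_ge0 ?exprn_ge0 ?ler0n //.
apply: le_trans (_ : x ^+ 2 * d%:R ^+ (n - 1) <= _).
  by rewrite ler_pM2r ?exprn_gt0.
apply: le_trans (_ : d%:R ^- 2 <= _); last first.
  by rewrite ler_peMl // invr_ge0 exprn_ge0 ?ler0n.
rewrite /x -exprVn -exprM exprVn ler_pdivrMl ?exprn_gt0 //.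
rewrite ler_pdivlMr ?exprn_gt0 // -exprD ler_weXn2l ?ler1n //; last by rewrite /c; lia.
by lia.
Unshelve. all: by end_near. Qed.
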